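(* Let $G$ be a finite group and suppose there is a $1$-rotational solution under $G$ to $OP(a_\infty, a_1, a_2,\dots,a_N)$, where $a_\infty$ is the length of the cycle through $\infty$ in the $2$-factors. Then: (i) if $a_1,\dots,a_N$ are all even, there exists a solution to $OP(2a_\infty-1,\ {}^2a_1,\ {}^2a_2,\dots,{}^2a_N)$; (ii) for every odd prime $p$, there exists a solution to $OP(p(a_\infty-1)+1,\ {}^pa_1,\ {}^pa_2,\dots,{}^pa_N)$.
   Context: For positive integers $t_1,\dots,t_s\ge 3$ with $v=t_1+\dots+t_s$, a solution to the Oberwolfach problem $OP(t_1,\dots,t_s)$ is a $2$-factorization of the complete graph $K_v$ (a set of spanning $2$-regular subgraphs whose edge sets partition the edges of $K_v$) in which every $2$-factor is isomorphic to the vertex-disjoint union of cycles $C_{t_1}\cup\dots\cup C_{t_s}$. The notation ${}^k t$ in the argument list means $t$ repeated $k$ times. For a finite group $G$, $\overline{G}=G\cup\{\infty\}$, $G$ acts on $\overline{G}$ by right multiplication with $\infty g=\infty$, and a $2$-factorization $\mathcal{F}$ of $K_{\overline{G}}$ is $1$-rotational if $Fg\in\mathcal{F}$ for all $F\in\mathcal{F}$, $g\in G$ (where $Fg$ is obtained by replacing each vertex $v$ by $vg$). A $1$-rotational solution under $G$ to $OP(a_\infty,a_1,\dots,a_N)$ is a $1$-rotational $2$-factorization of $K_{\overline{G}}$ whose $2$-factors are each isomorphic to $C_{a_\infty}\cup C_{a_1}\cup\dots\cup C_{a_N}$. *)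

(* Defs.v *)
From HB Require Import structures.
From mathcomp Require Import all_boot all_order all_fingroup.
Set Implicit Arguments. Unset Strict Implicit. Unset Printing Implicit Defensive.

(* Edges of K_V are 2-subsets of V.  A cycle is given by a duplicate-free
   sequence c of vertices; its edges are {x, next c x} for x in c. *)
Definition cycle_edges (V : finType) (c : seq V) : {set {set V}} :=
  [set [set x; next c x] | x in c].

Definition factor_cycles (V : finType) (F : {set {set V}}) (cs : seq (seq V)) : Prop :=
  perm_eq (flatten cs) (enum V) /\ F = \bigcup_(c <- cs) cycle_edges c.

Definition is_2factor_of_type (V : finType) (F : {set {set V}}) (ts : seq nat) : Prop :=
  all (leq 3) ts /\ exists cs : seq (seq V), map size cs = ts /\ factor_cycles F cs.

Definition is_2factorization (V : finType) (Fs : {set {set {set V}}}) : Prop :=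
  forall e : {set V}, #|e| = 2 -> exists! F, F \in Fs /\ e \in F.

Definition OP_solution (V : finType) (Fs : {set {set {set V}}}) (ts : seq nat) : Prop :=
  is_2factorization Fs /\ forall F, F \in Fs -> is_2factor_of_type F ts.

Definition OP_solvable (ts : seq nat) : Prop :=
  exists Fs : {set {set {set 'I_(sumn ts)}}}, OP_solution Fs ts.

(* G-bar = option gT, with None playing the role of infinity;
   right multiplication action, fixing infinity. *)
Definition ract (gT : finGroupType) (g : gT) (v : option gT) : option gT :=
  omap (fun x => (x * g)%g) v.

Definition factor_act (gT : finGroupType) (g : gT) (F : {set {set option gT}})
  : {set {set option gT}} := [set (ract g) @: e | e : {set option gT} in F].

Definition one_rotational (gT : finGroupType) (Fs : {set {set {set option gT}}}) : Prop :=
  forall F g, F \in Fs -> factor_act g F \in Fs.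

Definition one_rot_solution (gT : finGroupType) (Fs : {set {set {set option gT}}})
  (ainf : nat) (a : seq nat) : Prop :=
  [/\ is_2factorization Fs, one_rotational Fs &
    forall F, F \in Fs -> all (leq 3) (ainf :: a) /\
      exists (c0 : seq (option gT)) (cs : seq (seq (option gT))),
        [/\ None \in c0, map size (c0 :: cs) = ainf :: a & factor_cycles F (c0 :: cs)]].

(* Main.v *)
Require Import Defs.
From HB Require Import structures.
From mathcomp Require Import all_boot all_order all_fingroup.
From mathcomp Require Import all_algebra ring zify.
Set Implicit Arguments. Unset Strict Implicit. Unset Printing Implicit Defensive.
Import GRing.Theory.

(* Blow up every finite vertex x into the column {x} x Z_p, with a single point
   at infinity, and replace every factor F by p factors indexed by b in Z_p.
   Colour the finite vertices by h : T -> {0, 1, 2} so that colours of neighbours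
   in F differ by units of Z_p (for p = 2 this is where evenness is needed).  A
   finite cycle C of F lifts, in the b-th factor, to the p cycles
   {(x, a + b h x) : x in C}, a in Z_p; as b varies these cover every edge over
   an edge of C once.  The cycle (infinity, x_1, ..., x_k) loses infinity and
   lifts to p strands in the same way; traversing them alternately forwards and
   backwards, joined by vertical edges over x_1 and x_k, gives one cycle through
   infinity.  For p odd the vertical edges over each end form a near-1-factor of
   the column, whose centre runs through Z_p with b; for p = 2 the single
   vertical edge lies over x_1 or x_k according to b.  All edges get covered, and
   counting shows that each is covered once. *)

(** * Cycles as sequences and their edges *)

Section CycleEdges.
Variable V : finType.
Implicit Types (x y z : V) (c q : seq V) (cs : seq (seq V)).

Lemma set2_eq x y z t : x != y -> [set x; y] = [set z; t] ->
  (x = z /\ y = t) \/ (x = t /\ y = z).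
Proof.
move=> xy E; have := set21 x y; have := set22 x y; rewrite E !inE.
by case/orP=> /eqP Ey /orP[] /eqP Ex; move: xy; rewrite Ex Ey ?eqxx; auto.
Qed.

Lemma next_infix c x y : uniq c -> infix [:: x; y] c -> next c x = y.
Proof.
move=> Uc /infixP[c1 [c2 E]]; subst c.
have x_c1 : x \notin c1.
  by move: Uc; rewrite cat_uniq => /and3P[_ /= /norP[]].
rewrite next_nth mem_cat /= inE eqxx orbT.
case: c1 Uc x_c1 => [|z c1] /= Uc; first by rewrite eqxx.
rewrite inE negb_or => /andP[xz x_c1].
rewrite eq_sym (negPf xz) index_cat (negPf x_c1) /= eqxx addn0.
by rewrite nth_cat ltnNge leqnSn /= subSnn.
Qed.

Lemma next_last z q : uniq (z :: q) -> next (z :: q) (last z q) = z.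
Proof.
move=> U; rewrite next_nth mem_last.
by rewrite index_last // nth_default.
Qed.

Lemma infix_cycle_edges c x y :
  uniq c -> infix [:: x; y] c -> [set x; y] \in cycle_edges c.
Proof.
move=> Uc I; apply/imsetP; exists x; last by rewrite (next_infix Uc I).
by case/infixP: I => [c1 [c2 ->]]; rewrite mem_cat !inE eqxx orbT.
Qed.

Lemma last_cycle_edges z q :
  uniq (z :: q) -> [set z; last z q] \in cycle_edges (z :: q).
Proof.
move=> U; apply/imsetP; exists (last z q); first exact: mem_last.
by rewrite next_last // setUC.
Qed.

Lemma infix2_nth z q i :
  i.+1 < size q -> infix [:: nth z q i; nth z q i.+1] q.
Proof.
move=> lt; apply/infixP; exists (take i q), (drop i.+2 q).
by rewrite -{1}(cat_take_drop i q) (drop_nth z) ?(ltnW lt) // (drop_nth z lt).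
Qed.

(** Used with [z] at infinity: its two edges are separated from those of the path [q] that remains
    when it is deleted. *)
Lemma cycle_edges_cons z q e : uniq (z :: q) -> e \in cycle_edges (z :: q) ->
  [\/ e = [set z; head z q], e = [set z; last z q]
    | exists x y, infix [:: x; y] q /\ e = [set x; y]].
Proof.
move=> U /imsetP[x]; rewrite inE; case: (eqVneq x z) => [->|xz] xq ->.
  by constructor 1; rewrite next_nth mem_head /= eqxx nth0.
change (is_true (x \in q)) in xq; set i := index x q.
have Hi : i < size q by rewrite index_mem.
have Ex : nth z q i = x by rewrite nth_index.
have En : next (z :: q) x = nth z q i.+1.
  by rewrite next_nth inE xq orbT /= eq_sym (negPf xz).
case: (ltnP i.+1 (size q)) => Hs.
  by constructor 3; exists x, (nth z q i.+1); rewrite -En -{1}Ex En infix2_nth.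
(* Here [x] is the last entry of [q], and the default value [z] of [nth] closes the cycle. *)
constructor 2; rewrite En nth_default // setUC.
have -> // : last z q = x.
rewrite -nth_last -Ex; congr nth; lia.
Qed.

Lemma cycle_edges_rot n c : uniq c -> cycle_edges (rot n c) = cycle_edges c.
Proof.
move=> U; apply/setP=> e; apply/imsetP/imsetP=> -[x xc ->]; exists x => //;
  by rewrite ?next_rot ?mem_rot // -(mem_rot n).
Qed.

(** Each cycle has at most as many edges as vertices. Only this upper bound enters the counting
    argument. *)
Lemma card_factor F cs : factor_cycles F cs -> #|F| <= #|V|.
Proof.
case=> P ->; rewrite [X in _ <= X]cardE -(perm_size P) {P}.
elim: cs => [|c cs IH]; first by rewrite big_nil cards0.
rewrite big_cons /= size_cat (leq_trans (leq_card_setU _ _)) // leq_add //.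
exact: leq_trans (leq_imset_card _ _) (card_size _).
Qed.

End CycleEdges.

(** * Images of cycles, exactness by counting, relabelling of vertices *)

Lemma cycle_edges_map (V W : finType) (f : V -> W) c (e : {set V}) :
  injective f -> uniq c -> e \in cycle_edges c -> f @: e \in cycle_edges (map f c).
Proof.
move=> fI Uc /imsetP[x xc ->]; apply/imsetP; exists (f x); first exact: map_f.
by rewrite next_map // imsetU !imset_set1.
Qed.

Lemma cycle_edges_mapE (V W : finType) (f : V -> W) c :
  injective f -> uniq c ->
  cycle_edges (map f c) = [set f @: e | e : {set V} in cycle_edges c].
Proof.
move=> fI Uc; apply/setP=> e; apply/idP/imsetP=> [|[e' e'c ->]]; last exact: cycle_edges_map.
case/imsetP=> _ /mapP[x xc ->] ->; exists [set x; next c x]; first exact: imset_f.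
by rewrite next_map // imsetU !imset_set1.
Qed.

(* Equality in the count [#|L i| <= #|W|] forces every pair to be covered exactly once. *)
Lemma covering_2factorization (W I : finType) (A : {set I})
    (L : I -> {set {set W}}) :
  (forall i, i \in A -> #|L i| <= #|W|) ->
  (forall e : {set W}, #|e| = 2 -> exists2 i, i \in A & e \in L i) ->
  2 * #|A| <= #|W|.-1 ->
  is_2factorization (L @: A).
Proof.
move=> HL cov cA e e2.
pose E := [set f : {set W} | #|f| == 2].
pose m f := #|[set i in A | f \in L i]|.
have m_gt0 f : f \in E -> 0 < m f.
  rewrite inE => /eqP/cov[i iA fi]; apply/card_gt0P; exists i.
  by rewrite inE iA.
have sum_m : \sum_(f in E) m f <= \sum_(f in E) 1.
  (* Double counting of the pairs formed by an index and a 2-subset in its factor. *)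
  have -> : \sum_(f in E) m f = \sum_(i in A) #|L i :&: E|.
    transitivity (\sum_(f in E) \sum_(i in A | f \in L i) 1).
      by apply: eq_bigr => f _; rewrite sum1dep_card.
    rewrite (exchange_big_dep (mem A)) /=; last by move=> ? ? _ /andP[].
    apply: eq_bigr => i iA; rewrite sum1dep_card; apply: eq_card => f.
    by rewrite !inE iA andbC.
  have -> : \sum_(f in E) 1 = 'C(#|W|, 2) by rewrite sum1_card card_draws.
  apply: (@leq_trans (\sum_(i in A) #|W|)).
    apply: leq_sum => i iA; apply: leq_trans (HL i iA).
    exact/subset_leq_card/subsetIl.
  (* From [2 * #|A| <= #|W|.-1], the product [#|A| * #|W|] is at most half of [#|W| * #|W|.-1]. *)
  rewrite sum_nat_const bin2 -(half_bit_double (#|A| * #|W|) false) add0n.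
  apply: half_leq; rewrite -mul2n mulnA mulnC leq_mul2l cA orbT //.
have m1 : m e = 1.
  have eE : e \in E by rewrite inE e2.
  have := sum_m; rewrite (bigD1 e eE) [X in _ <= X](bigD1 e eE) /=.
  have : \sum_(f in E | f != e) 1 <= \sum_(f in E | f != e) m f.
    by apply: leq_sum => f /andP[/m_gt0].
  have := m_gt0 e eE; clear.
  move: (m e) (\sum_(f in E | f != e) _) (\sum_(f in E | f != e) _) => x y z.
  lia.
have [i Ei] : exists i, [set i in A | e \in L i] = [set i] by apply/cards1P/eqP.
have : i \in [set i] by rewrite inE.
rewrite -Ei inE => /andP[iA ei]; exists (L i); split; first by rewrite imset_f.
move=> _ [/imsetP[j jA ->] ej].
have : j \in [set i in A | e \in L i] by rewrite inE jA.
by rewrite Ei inE => /eqP->.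
Qed.

(** Vertices are renamed along the bijection [phi] obtained by matching enumerations; cycles and
    their edges are carried along. *)
Lemma OP_solvable_of (V : finType) (Fs : {set {set {set V}}}) ts :
  OP_solution Fs ts -> #|V| = sumn ts -> OP_solvable ts.
Proof.
case=> fac typ cV.
have eV : #|'I_(sumn ts)| = #|V| by rewrite card_ord.
pose phi (x : V) := enum_val (cast_ord (esym eV) (enum_rank x)).
pose psi (y : 'I_(sumn ts)) : V := enum_val (cast_ord eV (enum_rank y)).
have phiK : cancel phi psi.
  by move=> x; rewrite /psi enum_valK cast_ordKV enum_rankK.
have psiK : cancel psi phi.
  by move=> x; rewrite /phi enum_valK cast_ordK enum_rankK.
have phiI := can_inj phiK.
have setK (e : {set 'I_(sumn ts)}) : phi @: (psi @: e) = e.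
  by rewrite -imset_comp (eq_imset (g := id)) ?imset_id.
pose Phi (F : {set {set V}}) := [set phi @: e | e : {set V} in F].
have memPhi F e : (e \in Phi F) = (psi @: e \in F).
  apply/imsetP/idP => [[e' e'F ->]|]; last by exists (psi @: e); rewrite ?setK.
  by rewrite -imset_comp (eq_imset (g := id)) ?imset_id.
exists (Phi @: Fs); split.
  move=> e e2; have /fac[F [[FF eF] UF]] : #|psi @: e| = 2.
    by rewrite card_imset //; exact: can_inj psiK.
  exists (Phi F); split; first by rewrite memPhi imset_f.
  move=> _ [/imsetP[F' F'F ->]]; rewrite memPhi => eF'.
  by rewrite (UF F').
move=> _ /imsetP[F /typ[ge3 [cs [szs [P ->]]]] ->]; split=> //.
exists (map (map phi) cs); split.
  apply: etrans szs; rewrite -map_comp.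
  by apply: eq_map => c /=; rewrite size_map.
split.
  rewrite -map_flatten (perm_trans (perm_map phi P)) //.
  apply: uniq_perm; rewrite ?map_inj_uniq -?enumT ?enum_uniq //.
  move=> y; rewrite mem_enum inE; apply/mapP; exists (psi y) => //.
  by rewrite mem_enum.
have: uniq (flatten cs) by rewrite (perm_uniq P) enum_uniq.
rewrite /Phi; elim: cs {szs P} => [|c cs IH]; first by rewrite !big_nil imset0.
rewrite /= cat_uniq => /and3P[Uc _ Ucs].
by rewrite !big_cons imsetU IH // cycle_edges_mapE.
Qed.

Lemma map_infix (T U : eqType) (f : T -> U) s1 s2 :
  infix s1 s2 -> infix (map f s1) (map f s2).
Proof. by case/infixP=> s [s' ->]; rewrite !map_cat infix_infix. Qed.

(** * Colourings of cycles *)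

Section Colouring.
Variable T : eqType.
Implicit Types (c : seq T) (cs : seq (seq T)).

Lemma index_next c x :
  uniq c -> x \in c -> index (next c x) c = (index x c).+1 %% size c.
Proof.
case: c => // z q U xc; rewrite next_nth xc.
have : index x (z :: q) < (size q).+1 by rewrite -[X in _ < X]/(size (z :: q)) index_mem.
rewrite ltnS leq_eqVlt => /predU1P[->|lt].
  by rewrite nth_default // modnn /= eqxx.
rewrite modn_small ?ltnS // -[nth z q _]/(nth z (z :: q) _.+1).
by rewrite index_uniq.
Qed.

(** Colours alternate 0, 1 along the cycle; an odd cycle gets the colour 2 at its last vertex. *)
Lemma cycle_colouring c : uniq c -> 1 < size c ->
  exists h : T -> nat, forall x, x \in c ->
    h x <= 1 + odd (size c) /\ h x <> h (next c x).
Proof.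
move=> U c2.
pose col i := if odd (size c) && (i == (size c).-1) then 2 else odd i : nat.
exists (fun x => col (index x c)) => x xc; split.
  by rewrite /col; case: (odd (size c)) => /=; [case: ifP => // _|]; case: (odd _).
rewrite index_next // /col; have : index x c < size c by rewrite index_mem.
move: (index x c) (size c) c2 => i n n2 lin.
(* Wrap-around: the successor has position 0 and colour 0, while the last vertex has colour 1 or
   2. *)
have [->|ne] := eqVneq i n.-1.
  rewrite andbT prednK ?modnn; last lia.
  have [] := boolP (odd n) => on; first by case: eqP => /=; lia.
  by have -> : odd n.-1 by lia.
rewrite andbF modn_small; last lia.
by case: ifP => _ /=; case: (odd i).
Qed.

(** Colourings chosen cycle by cycle glue because the cycles are disjoint. The path [q] is coloured
    by parity whatever its length, since infinity separates its ends. *)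
Lemma factor_colouring (q : seq T) cs :
  uniq (q ++ flatten cs) -> all (leq 3) (map size cs) ->
  exists h : T -> nat, (forall x, x \in q -> h x = odd (index x q)) /\
    forall c x, c \in cs -> x \in c ->
      h x <= 1 + odd (size c) /\ h x <> h (next c x).
Proof.
elim: cs => [|c cs IH] /=; first by exists (fun x => odd (index x q)).
rewrite uniq_catCA cat_uniq => /and3P[Uc /hasPn dis Ucs] /andP[c3 cs3].
have [h [hq hcs]] := IH Ucs cs3.
have [h' hc] := cycle_colouring Uc (ltnW c3).
have nc x : x \in q ++ flatten cs -> x \in c = false.
  by move=> /dis/negPf.
exists (fun x => if x \in c then h' x else h x); split=> [x xq|d x].
  by rewrite nc ?hq // mem_cat xq.
rewrite inE => /predU1P[->|dcs] xd; first by rewrite mem_next xd; exact: hc.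
have nd y : y \in d -> y \in c = false.
  by move=> yd; apply: nc; rewrite mem_cat orbC; apply/orP; left; apply/flattenP; exists d.
by rewrite !nd ?mem_next //; apply: hcs.
Qed.

End Colouring.

(** * Joining strands into one path by alternating directions *)

Section Zigzag.
Variables (I T U : eqType) (f : I -> T -> U) (x : T) (q : seq T).

(** The entries of [s] name the copies of the path [x :: q]; [fl] tells whether the first copy is
    run backwards. *)
Fixpoint zigzag (fl : bool) (s : seq I) : seq U :=
  if s is a :: s' then
    map (f a) (if fl then rev (x :: q) else x :: q) ++ zigzag (~~ fl) s'
  else [::].

(** A strand run with flag [fl] starts at [endpoint fl] and stops at [endpoint (~~ fl)]. *)
Definition endpoint (fl : bool) := if fl then last x q else x.

Lemma perm_zigzag fl s : perm_eq (zigzag fl s) [seq f a y | a <- s, y <- x :: q].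
Proof.
elim: s fl => [|a s IH] fl //; rewrite allpairs_cons [zigzag _ _]/= perm_cat //.
by case: fl; rewrite // map_rev perm_rev.
Qed.

Lemma strand_head fl : exists r, (if fl then rev (x :: q) else x :: q) = endpoint fl :: r.
Proof.
by case: fl; [rewrite lastI rev_rcons; eexists | exists q].
Qed.

Lemma strand_last fl :
  exists r, (if fl then rev (x :: q) else x :: q) = rcons r (endpoint (~~ fl)).
Proof.
by case: fl; [exists (rev q); rewrite rev_cons | exists (belast x q); rewrite lastI].
Qed.

Lemma zigzag_head fl a s :
  exists r, zigzag fl (a :: s) = f a (endpoint fl) :: r.
Proof. by have [r E] := strand_head fl; rewrite /= E; eexists. Qed.

(** Flags alternate, so the last strand has flag [fl (+) odd (size s)] and stops at the opposite
    end. *)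
Lemma last_zigzag z fl a s :
  last z (zigzag fl (a :: s)) = f (last a s) (endpoint (fl (+) ~~ odd (size s))).
Proof.
elim: s a fl z => [|b s IH] a fl z.
  by have [r E] := strand_last fl; rewrite /= E cats0 map_rcons last_rcons addbT.
by rewrite [zigzag _ _]/= last_cat IH /=; case: fl; case: odd.
Qed.

Lemma infix_zigzag fl s a y z : a \in s -> infix [:: y; z] (x :: q) ->
  infix [:: f a y; f a z] (zigzag fl s) \/ infix [:: f a z; f a y] (zigzag fl s).
Proof.
move=> + inf; elim: s fl => // b s IH fl; rewrite inE => /predU1P[<-|/(IH (~~ fl))].
  case: fl; [right|left]; apply/infix_catr.
    by apply: (@map_infix _ _ _ [:: z; y]); rewrite -[[:: z; y]]/(rev [:: y; z]) infix_rev.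
  exact: (@map_infix _ _ _ [:: y; z]).
by case=> H; [left|right]; apply: infix_catl.
Qed.

(** Consecutive strands run in opposite directions, so the second starts over the vertex where the
    first stops: the joint is vertical. *)
Lemma zigzag_joint fl s i a0 : i.+1 < size s ->
  let e := endpoint (~~ (fl (+) odd i)) in
  infix [:: f (nth a0 s i) e; f (nth a0 s i.+1) e] (zigzag fl s).
Proof.
elim: s fl i => // a s IH fl [|i] /=; last first.
  by rewrite ltnS addbN -addNb => /(IH (~~ fl)) H; apply: infix_catl.
case: s {IH} => // b s _; rewrite addbF.
have [r ->] := strand_last fl; have [r' ->] := zigzag_head (~~ fl) b s.
rewrite map_rcons cat_rcons; apply/infixP.
by exists (map (f a) r), r'.
Qed.

End Zigzag.

(** * Orders in which the strands are traversed *)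

Section StrandOrder.
Local Open Scope ring_scope.

(* [s b] lists the strands of the cycle through infinity of the [b]-th factor in
   the order of traversal, the first one backwards iff [fl b]; [k e] is the colour
   of the first ([e = false]) or last ([e = true]) vertex of the strands. *)
Definition strand_order p (k : bool -> nat) (s : 'Z_p -> seq 'Z_p)
    (fl : 'Z_p -> bool) : Prop :=
  [/\ forall b, perm_eq (s b) (enum 'Z_p),
      forall e v, exists b, (fl b = e /\ head 0 (s b) + b * (k e)%:R = v) \/
        (fl b (+) odd (size (s b)) = e /\ last 0 (s b) + b * (k e)%:R = v)
    & forall e u v, u <> v -> exists b i, [/\ (i.+1 < size (s b))%N,
        ~~ (fl b (+) odd i) = e &
        let w j := nth 0 (s b) j + b * (k e)%:R in
        (w i = u /\ w i.+1 = v) \/ (w i = v /\ w i.+1 = u)]].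

Lemma strand_order_two k : exists s fl, @strand_order 2 k s fl.
Proof.
have Z2 (z : 'Z_2) : z = 0 \/ z = 1.
  by case: z => [[|[|//]] lt]; [left|right]; apply: val_inj.
exists (fun=> [:: 0; 1]), (fun b => b != 0); split.
- move=> b; apply: uniq_perm; rewrite ?enum_uniq // => z.
  by rewrite mem_enum !inE; case: (Z2 z) => ->.
(* Infinity is joined to both vertices over the first end when [b = 0], over the last end when
   [b = 1]. *)
- move=> e v; exists (if e then 1 else 0); rewrite /= addbF.
  case: (Z2 (v - (if e then 1 else 0) * (k e)%:R)) => E; [left|right];
    by (split; [case: e {E}|rewrite -[X in (X + _)%R]E subrK]).
(* The only joint lies over the end not adjacent to infinity, hence the opposite choice of [b]. *)
move=> e u v uv; exists (if e then 0 else 1), 0%N; split=> //=; first by case: e.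
set c := _ * _.
case: (Z2 (u - c)) => Eu; case: (Z2 (v - c)) => Ev.
- by case: uv; apply: (addIr (- c)); rewrite Eu Ev.
- by left; rewrite -Eu -Ev !subrK.
- by right; rewrite -Eu -Ev !subrK.
- by case: uv; apply: (addIr (- c)); rewrite Eu Ev.
Qed.

Section Odd.
Variables (p : nat) (p_gt1 : (1 < p)%N) (p_odd : odd p).

Lemma unit_Zp_le2 k : (0 < k <= 2)%N -> (k%:R : 'Z_p) \is a GRing.unit.
Proof.
rewrite unitZpE //; case: k => [|[|[|//]]] // _; first exact: coprimen1.
by rewrite coprimen2.
Qed.

(* The order b, b + 2, b - 2, b + 4, b - 4, ..., b + 1. *)
Definition zz_strand (b : 'Z_p) i := b + (if odd i then i.+1%:R else - i%:R).

Definition zz_order b := [seq zz_strand b i | i <- iota 0 p].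

Lemma size_zz_order b : size (zz_order b) = p.
Proof. by rewrite size_map size_iota. Qed.

Lemma nth_zz_order b i : (i < p)%N -> nth 0 (zz_order b) i = zz_strand b i.
Proof. by move=> lt; rewrite (nth_map 0%N) ?size_iota // nth_iota. Qed.

Lemma pnatr0 : p%:R = 0 :> 'Z_p.
Proof. exact: pchar_Zp. Qed.

Lemma zz_strand_surj b a : exists2 i, (i < p)%N & a = zz_strand b i.
Proof.
pose j := val (b - a).
have jp : (j < p)%N by rewrite -[X in (_ < X)%N](Zp_cast p_gt1) ltn_ord.
have Ej : a = b - j%:R by rewrite natr_Zp; ring.
have [oj|ej] := boolP (odd j).
  (* Modulo [p], [b - j] is [b + (p - j)]; as [p - j] is even, this value stands at the odd position
     [p - j - 1]. *)
  exists (p - j).-1; first lia.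
  have -> : zz_strand b (p - j).-1 = b + (p - j)%:R.
    by rewrite /zz_strand prednK ?subn_gt0 // ifT //; lia.
  by rewrite natrB ?pnatr0 ?(ltnW jp) // sub0r.
by exists j => //; rewrite /zz_strand (negPf ej).
Qed.

(** A list of length [p] that meets every element of ['Z_p] has no repetition. *)
Lemma perm_zz_order b : perm_eq (zz_order b) (enum 'Z_p).
Proof.
have sub : {subset enum 'Z_p <= zz_order b}.
  move=> a _; have [i ip ->] := zz_strand_surj b a.
  by apply: map_f; rewrite mem_iota.
have sz : (size (zz_order b) <= size (enum 'Z_p))%N.
  by rewrite size_zz_order -cardE card_ord Zp_cast.
have [_ eqi] := uniq_min_size (enum_uniq _) sub sz.
rewrite perm_sym; apply: uniq_perm; rewrite ?enum_uniq //.
exact: leq_size_uniq (enum_uniq _) sub sz.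
Qed.

(* Around [b] the strands are swapped at joints after odd positions,
   around [b + 1] at joints after even positions. *)
Lemma zz_joint b (e : bool) u v : u <> v -> u + v = 2%:R * (b + e%:R) ->
  exists i, [/\ (i.+1 < p)%N, odd i = ~~ e &
    (zz_strand b i = u /\ zz_strand b i.+1 = v) \/
    (zz_strand b i = v /\ zz_strand b i.+1 = u)].
Proof.
move=> uv uvE; have Ev : v = 2%:R * (b + e%:R) - u by rewrite -uvE; ring.
have [i ip Eu] := zz_strand_surj b u.
have [oi|oi] := boolP (odd i == ~~ e).
  exists i; have ip1 : (i.+1 < p)%N.
    (* The last position [p - 1] is even, so [e] holds; its strand [b + 1] is the centre of the
       reflection, which would force [u = v]. *)
    case: (ltnP i.+1 p) => // pi; have ip' : i = p.-1 by lia.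
    case: uv; rewrite Ev Eu ip' /zz_strand.
    have -> : odd p.-1 = false by lia.
    have -> : e = true by move: oi; rewrite ip'; case: e {uvE Ev} => //=; lia.
    have G (R : comRingType) (c : R) : c - (0 - 1) = 2%:R * (c + 1) - (c - (0 - 1)).
      by ring.
    by rewrite -subn1 natrB ?pnatr0; [exact: G|lia].
  split=> //; first exact/eqP.
  left; split=> //; rewrite Ev Eu /zz_strand /= (eqP oi) negbK -!natr1.
  by case: e {uvE Ev oi} => /=; ring.
(* Now [v] is sought just before [u]. Position 0 is excluded: there [e] fails and [u = b] is the
   centre. *)
case: i ip Eu oi => [|i] ip Eu oi.
  case: uv; rewrite Ev Eu; move: oi; rewrite /zz_strand /=.
  by case: e {uvE Ev} => //= _; ring.
have oi' : odd i = ~~ e by move: oi => /=; case: odd; case: e {uvE Ev}.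
exists i; split=> //; right; split=> //.
rewrite Ev Eu /zz_strand /= oi' negbK -!natr1.
by case: e {uvE Ev oi oi'} => /=; ring.
Qed.

(** Over the end [e], the vertical edges of the factor [b] pair points symmetric about
    [b * (1 + k e) + e], and this centre is the vertex joined to infinity. Since [1 + k e] is a
    unit, the centre runs through ['Z_p] with [b]. *)
Lemma strand_order_odd k : (forall e, k e <= 1)%N ->
  strand_order k zz_order (fun=> false).
Proof.
move=> k1.
have uk e : (1 + (k e)%:R : 'Z_p) \is a GRing.unit.
  by rewrite addrC natr1; apply: unit_Zp_le2; exact: k1.
have u2 : (2%:R : 'Z_p) \is a GRing.unit by rewrite unit_Zp_le2.
have solve e (w : 'Z_p) : exists b, b * (1 + (k e)%:R) = w.
  by exists (w / (1 + (k e)%:R)); rewrite divrK.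
split; first exact: perm_zz_order.
  move=> e v; have [b Eb] := solve e (v - e%:R); exists b.
  have Ev : v = b + e%:R + b * (k e)%:R by rewrite -[LHS](subrK e%:R) -Eb; ring.
  have p0 : (0 < p)%N by apply: ltnW.
  rewrite size_zz_order p_odd Ev -nth0 -nth_last size_zz_order !nth_zz_order ?prednK //.
  case: e {Eb Ev} => /=; [right|left]; split=> //; congr (_ + _).
    rewrite /zz_strand; have -> : odd p.-1 = false by lia.
    by rewrite -subn1 natrB // pnatr0; ring.
  by rewrite /zz_strand /=; ring.
(* The centre has to be the midpoint of [u] and [v]. *)
move=> e u v uv; have [b Eb] := solve e ((u + v) / 2%:R - e%:R).
have E2 : u + v = 2%:R * (b * (1 + (k e)%:R) + e%:R).
  by rewrite Eb subrK mulrC divrK.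
(* Subtracting the shift [c] turns positions in the column into strand labels. *)
pose c := b * (k e)%:R.
have [||i [ip oi H]] := @zz_joint b e (u - c) (v - c).
- by move=> /addIr.
- by rewrite addrACA E2 /c; ring.
exists b, i; rewrite size_zz_order; split=> //; first by rewrite addFb oi negbK.
rewrite /= !nth_zz_order // ?(ltnW ip) //.
by case: H => -[-> ->]; rewrite !subrK; auto.
Qed.

End Odd.
End StrandOrder.

(** * Factors seen from the vertex at infinity *)

Lemma map_Some_pmap (T : eqType) (s : seq (option T)) :
  None \notin s -> map Some (pmap id s) = s.
Proof. by elim: s => [|[x|] s IH] //=; rewrite inE /= => /IH->. Qed.

Lemma mem_bigcup_seq (I : eqType) (V : finType) (cs : seq I) (E : I -> {set V}) e :
  reflect (exists2 c, c \in cs & e \in E c) (e \in \bigcup_(c <- cs) E c).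
Proof.
apply: (iffP idP).
  elim: cs => [|c cs IH]; first by rewrite big_nil inE.
  rewrite big_cons inE => /orP[ec|/IH[d dcs ed]]; first by exists c; rewrite ?mem_head.
  by exists d; rewrite // inE dcs orbT.
case=> c + ec; elim: cs => // d cs IH; rewrite inE big_cons inE.
by case/predU1P=> [<-|/IH->]; rewrite ?ec ?orbT.
Qed.

Lemma uniq_flatten_mem (T : eqType) (c : seq T) cs :
  c \in cs -> uniq (flatten cs) -> uniq c.
Proof.
elim: cs => // d cs IH; rewrite inE /= cat_uniq.
by case/predU1P=> [->|/IH H] /and3P[].
Qed.

Lemma index_infix (T : eqType) (q : seq T) u v :
  uniq q -> infix [:: u; v] q -> index v q = (index u q).+1.
Proof.
move=> Uq /infixP[s [t E]].
have lt : (size s).+1 < size q by rewrite E size_cat /= !addnS !ltnS leq_addr.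
have -> : v = nth u q (size s).+1 by rewrite E nth_cat ltnNge leqnSn subSnn.
have {2}-> : u = nth u q (size s) by rewrite E nth_cat ltnn subnn.
by rewrite !index_uniq // ltnW.
Qed.

(** The cycle through infinity is rotated to start there, which leaves a path [q]; no other vertex
    is [None], so [Some] can be stripped everywhere else. *)
Lemma factor_at_infinity (T : finType) (F : {set {set option T}}) c0 cs :
  None \in c0 -> factor_cycles F (c0 :: cs) ->
  exists q cs', [/\ perm_eq (q ++ flatten cs') (enum T), size c0 = (size q).+1,
    map size cs' = map size cs &
    F = cycle_edges (None :: map Some q) :|:
        \bigcup_(c <- cs') cycle_edges (map Some c)].
Proof.
move=> c0N [P ->].
have U : uniq (flatten (c0 :: cs)) by rewrite (perm_uniq P) enum_uniq.
have [i r Er] := rot_to c0N.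
move: (U); rewrite /= cat_uniq => /and3P[Uc0 /hasPn dis Ucs].
have rN : None \notin r by move: Uc0; rewrite -(rot_uniq i) Er => /andP[].
pose q := pmap id r; have Eq : map Some q = r by rewrite map_Some_pmap.
pose cs' := map (pmap id) cs; have Ecs : map (map Some) cs' = cs.
  rewrite -map_comp -[RHS]map_id; apply/eq_in_map => c ccs /=; apply: map_Some_pmap.
  apply/negP => cN; have /dis/negP[] // : None \in flatten cs.
  by apply/flattenP; exists c.
have Ep : perm_eq (None :: map Some (q ++ flatten cs')) (enum {: option T}).
  rewrite map_cat Eq map_flatten Ecs -cat_cons -Er; apply: perm_trans P.
  by rewrite perm_cat2r perm_rot.
exists q, cs'; split.
- apply: uniq_perm; rewrite ?enum_uniq //.
    have: uniq (None :: map Some (q ++ flatten cs')).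
      by rewrite (perm_uniq Ep) enum_uniq.
    by rewrite cons_uniq => /andP[_]; rewrite map_inj_uniq // => x y [].
  move=> x; rewrite mem_enum !inE.
  have := perm_mem Ep (Some x); rewrite inE /= mem_enum !inE.
  by rewrite mem_map // => y z [].
- by rewrite -(size_rot i) Er /= -Eq size_map.
- rewrite -[in RHS]Ecs -[RHS]map_comp; apply: eq_map => c /=; by rewrite size_map.
by rewrite big_cons -(cycle_edges_rot i Uc0) Er Eq -[in LHS]Ecs big_map.
Qed.

(** The two ends of the path [q] are neighbours of infinity, distinct because the cycle has at least
    three vertices. *)
Lemma factor_degree_infinity (T : finType) (F : {set {set option T}}) c0 cs :
  None \in c0 -> 2 < size c0 -> factor_cycles F (c0 :: cs) ->
  2 <= #|[set x : T | [set None; Some x] \in F]|.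
Proof.
move=> c0N c3 Fc; have [q [cs' [P]]] := factor_at_infinity c0N Fc.
move=> sz _ ->; rewrite sz in c3; case: q P sz c3 => [|x [|y q]] // P _ _.
have U : uniq (x :: y :: q).
  have: uniq ((x :: y :: q) ++ flatten cs') by rewrite (perm_uniq P) enum_uniq.
  by rewrite cat_uniq => /and3P[].
have U' : uniq (None :: map Some (x :: y :: q)).
  rewrite cons_uniq map_inj_uniq ?U ?andbT => [|? ? []] //.
  by apply/mapP=> -[].
have xl : x != last y q.
  by apply/eqP => E; move: U; rewrite /= {1}E mem_last.
have <- : #|[set x; last y q]| = 2 by rewrite cards2 xl.
apply/subset_leq_card/subsetP => z; rewrite !inE => /orP[] /eqP->.
  apply/orP; left; apply: infix_cycle_edges U' _.
  by apply/infixP; exists [::], (map Some (y :: q)).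
apply/orP; left; have := last_cycle_edges U'.
by rewrite [last _ _]/= last_map.
Qed.

(** Up to sign, the difference is 1 or 2 for odd [p], and 1 for [p = 2]. *)
Lemma unit_Zp_sub p k l : 1 < p ->
    (odd p /\ k <= 2 /\ l <= 2) \/ (p = 2 /\ k <= 1 /\ l <= 1) -> k <> l ->
  ((k%:R - l%:R)%R : 'Z_p) \is a GRing.unit.
Proof.
move=> p_gt1; wlog lt : k l / l < k => [H hyp kl|hyp _].
  have [lt|lt|//] := ltngtP k l; last by apply: H.
  by rewrite -unitrN opprB; apply: H => //; [tauto | move=> E; apply: kl].
rewrite -natrB ?(ltnW lt) //; case: hyp => [[op [k2 l2]]|[p2 [k1 l1]]].
  by apply: unit_Zp_le2 => //; lia.
have -> : k - l = 1 by lia.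
exact: unitr1.
Qed.

Lemma sumn_flatten_nseq p ts : sumn (flatten [seq nseq p t | t <- ts]) = p * sumn ts.
Proof.
by elim: ts => [|t ts IH] /=; rewrite ?muln0 // sumn_cat sumn_nseq IH mulnDr mulnC.
Qed.

Lemma infix2_map (T U : eqType) (f : T -> U) s y z : infix [:: y; z] (map f s) ->
  exists y' z', [/\ infix [:: y'; z'] s, y = f y' & z = f z'].
Proof.
case/infixP=> c1 [c2 E].
have : map f (drop (size c1) s) = y :: z :: c2 by rewrite map_drop E drop_size_cat.
case D: (drop _ s) => [|y' [|z' r]] //= [<- <- _]; exists y', z'; split=> //.
apply/infixP; exists (take (size c1) s), r.
by rewrite -{1}(cat_take_drop (size c1) s) D.
Qed.

(** * Lifting a single factor *)

Section Lift.
Variables (T : finType) (p : nat).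
Hypothesis p_gt1 : 1 < p.
Implicit Types (x u v : T) (a b alpha beta : 'Z_p).

Definition lift_vertex (h : T -> nat) b a x : option (T * 'Z_p) :=
  Some (x, (a + b * (h x)%:R)%R).

Lemma lift_vertex_inj h b a : injective (lift_vertex h b a).
Proof. by move=> x y [->]. Qed.

Lemma card_Zp_ord : #|'Z_p| = p.
Proof. by rewrite card_ord Zp_cast. Qed.

(** The prescribed heights at two abscissas with invertible difference determine a line of slope [b]
    and intercept [a]. *)
Lemma lift_edge h u v alpha beta :
  (((h u)%:R - (h v)%:R)%R : 'Z_p) \is a GRing.unit ->
  exists a b, lift_vertex h b a u = Some (u, alpha) /\ lift_vertex h b a v = Some (v, beta).
Proof.
move=> U; pose b := ((alpha - beta) / ((h u)%:R - (h v)%:R))%R.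
exists (alpha - b * (h u)%:R)%R, b; rewrite /lift_vertex subrK; split=> //.
congr (Some (_, _)); have E : (b * ((h u)%:R - (h v)%:R) = alpha - beta)%R.
  by rewrite divrK.
have -> : (alpha - b * (h u)%:R + b * (h v)%:R =
           alpha - b * ((h u)%:R - (h v)%:R))%R by ring.
by rewrite E subKr.
Qed.

Definition lift_cycles h b (cs : seq (seq T)) :=
  flatten [seq [seq map (lift_vertex h b a) c | a <- enum 'Z_p] | c <- cs].

Lemma size_lift_cycles h b cs :
  map size (lift_cycles h b cs) = flatten [seq nseq p t | t <- map size cs].
Proof.
rewrite /lift_cycles map_flatten -!map_comp; congr flatten; apply: eq_map => c /=.
have <- : nseq (size (enum 'Z_p)) (size c) = nseq p (size c).
  by rewrite -cardE card_Zp_ord.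
by elim: (enum _) => //= a s ->; rewrite size_map.
Qed.

Definition lift_zigzag h fl s x q b : seq (option (T * 'Z_p)) :=
  None :: zigzag (lift_vertex h b) x q (fl b) (s b).

Lemma mem_lift_zigzag h fl s x q b y alpha : perm_eq (s b) (enum 'Z_p) ->
  y \in x :: q -> Some (y, alpha) \in lift_zigzag h fl s x q b.
Proof.
move=> P yq; rewrite inE /= (perm_mem (perm_zigzag _ _ _ _ _)).
apply/allpairsP; exists ((alpha - b * (h y)%:R)%R, y); rewrite /= (perm_mem P).
by rewrite mem_enum yq /lift_vertex subrK.
Qed.

Lemma size_lift_zigzag h fl s x q b : perm_eq (s b) (enum 'Z_p) ->
  size (lift_zigzag h fl s x q b) = (p * (size q).+1).+1.
Proof.
move=> P; rewrite /= (perm_size (perm_zigzag _ _ _ _ _)) size_allpairs.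
by rewrite (perm_size P) -cardE card_Zp_ord.
Qed.

Lemma lift_zigzag_infinity h fl s x q e alpha :
  (forall b, uniq (lift_zigzag h fl s x q b)) ->
  strand_order (fun e => h (endpoint x q e)) s fl ->
  exists b, [set None; Some (endpoint x q e, alpha)]
    \in cycle_edges (lift_zigzag h fl s x q b).
Proof.
move=> U [P N _]; have [b Hb] := N e alpha; exists b; move: (U b).
have : size (s b) = p by rewrite (perm_size (P b)) -cardE card_Zp_ord.
rewrite /lift_zigzag; case: (s b) Hb => [|a r] Hb sz; first by move: p_gt1; rewrite -[X in _ < X]sz.
move=> Ub; case: Hb => -[<- <-].
  apply: infix_cycle_edges => //; have [t ->] := zigzag_head (lift_vertex h b) x q (fl b) a r.
  by apply/infixP; exists [::], t.
by have := last_cycle_edges Ub; rewrite last_zigzag.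
Qed.

Lemma lift_zigzag_vertical h fl s x q e alpha beta : alpha <> beta ->
  (forall b, uniq (lift_zigzag h fl s x q b)) ->
  strand_order (fun e => h (endpoint x q e)) s fl ->
  exists b, [set Some (endpoint x q e, alpha); Some (endpoint x q e, beta)]
    \in cycle_edges (lift_zigzag h fl s x q b).
Proof.
move=> ab U [_ _ V]; have [b [i [lt Ee H]]] := V e _ _ ab; exists b.
have := zigzag_joint (lift_vertex h b) x q (fl b) 0%R lt; rewrite Ee /= => J.
have := infix_cycle_edges (U b) (infix_catl [:: None] J); rewrite /lift_vertex.
by case: H => -[-> ->]; rewrite // setUC.
Qed.

Lemma lift_zigzag_strand h fl s x q u v a b : uniq (lift_zigzag h fl s x q b) ->
  perm_eq (s b) (enum 'Z_p) -> infix [:: u; v] (x :: q) ->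
  [set lift_vertex h b a u; lift_vertex h b a v] \in cycle_edges (lift_zigzag h fl s x q b).
Proof.
move=> U P I; have as_ : a \in s b by rewrite (perm_mem P) mem_enum.
have [J|J] := infix_zigzag (lift_vertex h b) (fl b) as_ I;
  have := infix_cycle_edges U (infix_catl [:: None] J) => //.
by rewrite setUC.
Qed.

(** Vertical edges are claimed only over neighbours of infinity in [F]. This is enough for a whole
    factorization, where each finite vertex is such a neighbour in some factor. *)
Lemma lift_factor (F : {set {set option T}}) c0 cs :
  (odd p \/ p = 2 /\ all (fun t => ~~ odd t) (map size cs)) ->
  None \in c0 -> all (leq 3) (map size (c0 :: cs)) -> factor_cycles F (c0 :: cs) ->
  exists L : 'Z_p -> {set {set option (T * 'Z_p)}},
  [/\ forall b, is_2factor_of_type (L b) ((p * (size c0 - 1) + 1) ::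
        flatten [seq nseq p t | t <- map size cs]),
    forall u v, u <> v -> [set Some u; Some v] \in F -> forall alpha beta,
      exists b, [set Some (u, alpha); Some (v, beta)] \in L b,
    forall u, [set None; Some u] \in F -> forall alpha,
      exists b, [set None; Some (u, alpha)] \in L b &
    forall u, [set None; Some u] \in F -> forall alpha beta, alpha <> beta ->
      exists b, [set Some (u, alpha); Some (u, beta)] \in L b].
Proof.
move=> hp c0N /= /andP[c03 cs3] Fc.
have [q0 [cs' [P sz szs EF]]] := factor_at_infinity c0N Fc.
rewrite -{}szs {}sz in hp c03 cs3 *; case: q0 P c03 EF => // x q P q2 EF.
have U : uniq ((x :: q) ++ flatten cs') by rewrite (perm_uniq P) enum_uniq.
have [h [hq hcs]] := factor_colouring U cs3.
move: (U); rewrite cat_uniq => /and3P[Uq _ Ucs].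
have endq e : endpoint x q e \in x :: q.
  by case: e; [exact: mem_last | exact: mem_head].
(* On the path colours are parities, so both ends have colour at most 1, as the odd case asks. *)
have [s [fl so]] : exists s fl, @strand_order p (fun e => h (endpoint x q e)) s fl.
  case: hp => [p_odd|[p2 _]]; last first.
    by rewrite p2; exact: strand_order_two.
  exists (@zz_order p), (fun=> false); apply: strand_order_odd => // e.
  by rewrite hq //; case: odd.
have [Ps _ _] := so.
pose C := lift_zigzag h fl s x q.
pose css b := C b :: lift_cycles h b cs'.
have szss b : map size (css b) =
    (p * ((size (x :: q)).+1 - 1) + 1) :: flatten [seq nseq p t | t <- map size cs'].
  rewrite -[LHS]/(size (C b) :: map size (lift_cycles h b cs')).
  by rewrite size_lift_cycles size_lift_zigzag // subn1 addn1.
(* Every vertex occurs and the lengths add up to [p * #|T| + 1], so none occurs twice. *)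
have Pss b : perm_eq (flatten (css b)) (enum {: option (T * 'Z_p)}).
  have sub : {subset enum {: option (T * 'Z_p)} <= flatten (css b)}.
    case=> [[y alpha]|] _; last by rewrite inE.
    have : y \in (x :: q) ++ flatten cs' by rewrite (perm_mem P) mem_enum.
    rewrite mem_cat => /orP[yq|/flattenP[c ccs yc]].
      by rewrite mem_cat mem_lift_zigzag.
    rewrite mem_cat; apply/orP; right; apply/flattenP.
    exists (map (lift_vertex h b (alpha - b * (h y)%:R)%R) c).
      by apply/flatten_mapP; exists c => //; apply: map_f; rewrite mem_enum.
    by apply/mapP; exists y; rewrite // /lift_vertex subrK.
  have szf : size (flatten (css b)) <= size (enum {: option (T * 'Z_p)}).
    rewrite size_flatten /shape szss -cardE card_option card_prod card_Zp_ord.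
    rewrite [#|T|]cardE -(perm_size P) size_cat size_flatten /shape /= subn1 addn1.
    by rewrite sumn_flatten_nseq; lia.
  have [_ E] := uniq_min_size (enum_uniq _) sub szf.
  apply: uniq_perm; rewrite ?enum_uniq //.
  exact: leq_size_uniq (enum_uniq _) sub szf.
have Uss b : uniq (flatten (css b)) by rewrite (perm_uniq (Pss b)); exact: enum_uniq.
have UC b : uniq (C b) by apply: (uniq_flatten_mem _ (Uss b)); rewrite mem_head.
pose L b := \bigcup_(c <- css b) cycle_edges c.
have CL b e : e \in cycle_edges (C b) -> e \in L b.
  by move=> eC; apply/mem_bigcup_seq; exists (C b); rewrite ?mem_head.
have U' : uniq (None :: map Some (x :: q)).
  rewrite cons_uniq map_inj_uniq ?Uq ?andbT => [|? ? []] //.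
  by apply/mapP=> -[].
have inf_end u : [set None; Some u] \in F -> exists e, u = endpoint x q e.
  have eqS y : [set None; Some u] = [set None; Some y] -> u = y.
    move=> E; have : Some u \in [set None; Some y] by rewrite -E set22.
    by rewrite !inE => /eqP[].
  have nS y z : [set None; Some u] <> [set Some y; Some z].
    by move=> E; have := set21 None (Some u); rewrite E !inE.
  rewrite EF inE => /orP[/(cycle_edges_cons U')[/eqS->|E|[y [z [I]]]]|].
  - by exists false.
  - by exists true; apply: eqS; rewrite E [last _ _]/= last_map.
  - by have [y' [z' [_ -> ->]]] := infix2_map I => /nS.
  case/mem_bigcup_seq=> c ccs /imsetP[_ /mapP[y _ ->]].
  by rewrite (next_map (@Some_inj _) (uniq_flatten_mem ccs Ucs)) => /nS.
exists L; split.
- move=> b; split; last by exists (css b); rewrite szss; split.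
  apply/andP; split; first by move: q2 p_gt1 => /=; nia.
  by apply/allP=> t /flatten_mapP[t' /(allP cs3) t3 /nseqP[->]].
- move=> u v uv uvF.
  (* The claim is symmetric in the two endpoints, so the edge may be oriented along its cycle. *)
  suff [y [z [E yz]]] : exists y z, [set Some u; Some v] = [set Some y; Some z] /\
      forall alpha beta, exists b, [set Some (y, alpha); Some (z, beta)] \in L b.
    have {}uv : Some u != Some v by apply/eqP => -[].
    move=> alpha beta; case: (set2_eq uv E) => -[[->] [->]]; first exact: yz.
    by have [b Hb] := yz beta alpha; exists b; rewrite setUC.
  have nN y : [set Some u; Some v] <> [set None; y].
    by move=> E; have := set21 None y; rewrite -E !inE.
  move: uvF; rewrite EF inE => /orP[/(cycle_edges_cons U')[/nN|/nN|[y' [z' [I ->]]]] //|].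
    have [y [z [{}I -> ->]]] := infix2_map I.
    exists y, z; split=> // alpha beta.
    have [yq zq] : y \in x :: q /\ z \in x :: q.
      by split; apply: (mem_infix I); rewrite !inE eqxx ?orbT.
    have [|a [b [<- <-]]] := @lift_edge h y z alpha beta.
      (* Consecutive positions on the path have opposite parities. *)
      rewrite !hq // (index_infix Uq I) /=.
      apply: unit_Zp_sub => //; last by case: (odd (index y (x :: q))).
      by case: hp => [p_odd|[p2 _]]; [left|right]; case: (odd (index y (x :: q))).
    by exists b; apply/CL/lift_zigzag_strand.
  case/mem_bigcup_seq=> c ccs /imsetP[_ /mapP[y yc ->]].
  have Uc := uniq_flatten_mem ccs Ucs; rewrite (next_map (@Some_inj _) Uc) => ->.
  exists y, (next c y); split=> // alpha beta.
  have [hy hyn] := hcs c y ccs yc.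
  have [hn _] := hcs c (next c y) ccs (etrans (mem_next c y) yc).
  have [|a [b [<- <-]]] := @lift_edge h y (next c y) alpha beta.
    (* When [p = 2], evenness of the cycle keeps the colours in {0, 1}. *)
    apply: unit_Zp_sub => //; case: hp => [p_odd|[p2 /allP even_cs]]; [left|right].
      by split=> //; move: hy hn; case: odd; lia.
    have /negPf ec := even_cs _ (map_f size ccs).
    by move: hy hn; rewrite ec.
  exists b; apply/mem_bigcup_seq; exists (map (lift_vertex h b a) c).
    rewrite inE; apply/orP; right; apply/flatten_mapP; exists c => //.
    by apply: map_f; rewrite mem_enum.
  have := cycle_edges_map (@lift_vertex_inj h b a) Uc (imset_f (fun x => [set x; next c x]) yc).
  by rewrite imsetU !imset_set1.
- move=> u /inf_end[e ->] alpha.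
  have [b /CL Hb] := lift_zigzag_infinity e alpha UC so.
  by exists b.
move=> u /inf_end[e ->] alpha beta ab.
have [b /CL Hb] := lift_zigzag_vertical e ab UC so.
by exists b.
Qed.
End Lift.

(* Every factor takes at least two of the [#|T|] edges at infinity. *)
Lemma card_2factorization (T : finType) (Fs : {set {set {set option T}}}) :
  is_2factorization Fs ->
  (forall F, F \in Fs -> 2 <= #|[set x : T | [set None; Some x] \in F]|) ->
  2 * #|Fs| <= #|T|.
Proof.
move=> fac deg.
(* Each edge at infinity lies in exactly one factor, so every summand is 1. *)
have -> : #|T| = \sum_(x : T) #|[set F in Fs | [set None; Some x] \in F]|.
  rewrite -sum1_card; apply: eq_bigr => x _; apply/esym/eqP/cards1P.
  have /fac[F [[FF xF] UF]] : #|[set None; Some x]| = 2 by rewrite cards2.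
  exists F; apply/setP=> F'; rewrite !inE; apply/andP/eqP => [[F'F xF']|-> //].
  by rewrite (UF F').
rewrite mulnC -sum_nat_const.
have -> : \sum_(x : T) #|[set F in Fs | [set None; Some x] \in F]| =
          \sum_(F in Fs) #|[set x : T | [set None; Some x] \in F]|.
  transitivity (\sum_(x : T) \sum_(F in Fs | [set None; Some x] \in F) 1).
    by apply: eq_bigr => x _; rewrite sum1dep_card.
  rewrite (exchange_big_dep (mem Fs)) /=; last by move=> ? ? _ /andP[].
  apply: eq_bigr => F FF; rewrite sum1dep_card; apply: eq_card => x.
  by rewrite !inE FF.
exact: leq_sum.
Qed.

(** * Assembly of the blown-up factorization *)

Lemma OP_blow_up (T : finType) (t0 : T) (Fs : {set {set {set option T}}}) ainf a p :
  1 < p -> odd p \/ p = 2 /\ all (fun t => ~~ odd t) a ->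
  is_2factorization Fs ->
  (forall F, F \in Fs -> all (leq 3) (ainf :: a) /\
     exists c0 cs, [/\ None \in c0, map size (c0 :: cs) = ainf :: a &
       factor_cycles F (c0 :: cs)]) ->
  OP_solvable ((p * (ainf - 1) + 1) :: flatten [seq nseq p t | t <- a]).
Proof.
set ts := (_ + 1 :: _) => p_gt1 hp fac typ.
have /fin_all_exists[L HL] : forall F : {set {set option T}},
    exists L : 'Z_p -> {set {set option (T * 'Z_p)}}, F \in Fs ->
    [/\ forall b, is_2factor_of_type (L b) ts,
    forall u v, u <> v -> [set Some u; Some v] \in F -> forall alpha beta,
      exists b, [set Some (u, alpha); Some (v, beta)] \in L b,
    forall u, [set None; Some u] \in F -> forall alpha,
      exists b, [set None; Some (u, alpha)] \in L b &
    forall u, [set None; Some u] \in F -> forall alpha beta, alpha <> beta ->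
      exists b, [set Some (u, alpha); Some (u, beta)] \in L b].
  move=> F; have [FF|] := boolP (F \in Fs); last by exists (fun=> set0).
  have [a3 [c0 [cs [c0N [sz0 szs] Fc]]]] := typ F FF.
  have [||L HL] := lift_factor p_gt1 _ c0N _ Fc.
  - by rewrite szs.
  - by rewrite /= sz0 szs.
  by exists L => _; move: HL; rewrite sz0 szs.
pose A := [set i : {set {set option T}} * 'Z_p | i.1 \in Fs].
pose LA (i : {set {set option T}} * 'Z_p) := L i.1 i.2.
have cardA : #|A| = #|Fs| * p.
  have <- : #|Fs| * #|[set: 'Z_p]| = #|Fs| * p by rewrite cardsT card_Zp_ord.
  by rewrite -cardsX; apply: eq_card => i; rewrite !inE andbT.
have cardW : #|{: option (T * 'Z_p)}| = (#|T| * p).+1.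
  by rewrite card_option card_prod card_Zp_ord.
have cardFs : 2 * #|Fs| <= #|T|.
  apply: card_2factorization fac _ => F FF.
  have [/andP[ainf3 _] [c0 [cs [c0N [sz0 szs] Fc]]]] := typ F FF.
  by apply: factor_degree_infinity c0N _ Fc; rewrite sz0.
have inA F b e : F \in Fs -> e \in L F b -> exists2 i, i \in A & e \in LA i.
  by move=> FF eL; exists (F, b); rewrite ?inE.
have cov u v : u != v -> exists2 i, i \in A & [set u; v] \in LA i.
  have infty x alpha : exists2 i, i \in A & [set None; Some (x, alpha)] \in LA i.
    have /fac[F [[FF xF] _]] : #|[set None; Some x]| = 2 by rewrite cards2.
    have [_ _ /(_ _ xF alpha)[b Hb] _] := HL F FF.
    exact: inA FF Hb.
  case: u v => [[x alpha]|] [[y beta]|] //;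
    last by move=> _; rewrite setUC; apply: infty.
  have [->|xy] := eqVneq x y => uv.
    (* A vertical edge over [y] is found in a lift of the factor that joins [y] to infinity. *)
    have /fac[F [[FF yF] _]] : #|[set None; Some y]| = 2 by rewrite cards2.
    have ab : alpha <> beta by move=> E; rewrite E eqxx in uv.
    have [_ _ _ /(_ _ yF _ _ ab)[b Hb]] := HL F FF.
    exact: inA FF Hb.
  have /fac[F [[FF xyF] _]] : #|[set Some x; Some y]| = 2.
    by rewrite cards2 (inj_eq (@Some_inj _)) xy.
  have [_ /(_ _ _ (elimN eqP xy) xyF alpha beta)[b Hb] _ _] := HL F FF.
  exact: inA FF Hb.
have typA i : i \in A -> is_2factor_of_type (LA i) ts.
  by rewrite inE => /HL[+ _ _ _]; apply.
apply: (@OP_solvable_of _ (LA @: A)); first split.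
- apply: covering_2factorization.
  + by move=> i /typA[_ [cs [_ /card_factor]]].
  + by move=> e /eqP/cards2P[u [v [uv ->]]]; apply: cov.
  by rewrite cardW cardA mulnA leq_mul2r cardFs orbT.
- by move=> _ /imsetP[i iA ->]; apply: typA.
(* The point [t0] provides an edge, hence a factor, whose cycle lengths add up to the number of
   vertices. *)
have [i /typA[_ [cs [<- [P _]]]] _] := cov None (Some (t0, 0%R)) isT.
by rewrite [LHS]cardE -(perm_size P) size_flatten.
Qed.

Theorem theorem4p2 (gT : finGroupType) (ainf : nat) (a : seq nat) :
  (exists Fs : {set {set {set option gT}}}, one_rot_solution Fs ainf a) ->
  ((all (fun t => ~~ odd t) a) ->
     OP_solvable ((2 * ainf - 1) :: flatten [seq nseq 2 t | t <- a])) /\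
  (forall p : nat, prime p -> odd p ->
     OP_solvable ((p * (ainf - 1) + 1) :: flatten [seq nseq p t | t <- a])).
Proof.
case=> Fs [fac _ typ]; split=> [even_a|p p_prime p_odd].
  (* The factor through infinity and 1 gives [3 <= ainf], so the truncated subtractions agree with
     the true ones. *)
  have /fac[F [[/typ[/andP[ainf3 _] _] _] _]] : #|[set None; Some (1%g : gT)]| = 2.
    by rewrite cards2.
  have -> : 2 * ainf - 1 = 2 * (ainf - 1) + 1 by lia.
  by apply: (OP_blow_up 1%g _ _ fac typ); auto.
by apply: (OP_blow_up 1%g _ _ fac typ); [exact: prime_gt1 | left].
Qed.
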